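(* Let $\mathbb K$ be a non-Archimedean local field, $U\subseteq\mathbb K^n$ a nonempty open set, $\mathbf B=(B_j)_{1\le j\le m}$ a tuple of $C^1$ maps $B_j:U\to\mathbb K^{n_j}$, and $\mathbf c=(c_j)_{1\le j\le m}\in[0,1]^m$. Suppose $$n\le\sum_{j=1}^mc_jn_j.$$ Then $\operatorname{BL}(\mathbf B,\mathbf c)\ge\sup_{x\in U}\operatorname{BL}(d\mathbf B(x),\mathbf c)$.
   Context: $\mathbb K$ is a non-discrete non-Archimedean local field with absolute value $|\cdot|$ given by the modular function of Haar measure, $\mathcal O_1=\{|x|\le1\}$, $\mathcal O_k=\mathcal O_1^k\subset\mathbb K^k$; $\mathbb K^k$ carries the max norm and Haar measure normalized so that $\mathcal O_k$ has measure $1$. Schwartz--Bruhat functions are the compactly supported functions on $\mathbb K^k$ that are $h\mathcal O_k$-translation-invariant for some $h\in\mathbb K^\times$. $C^1$ maps: let $F:U\to\mathbb K^l$. For a ball $x+\delta\mathcal O_n\subseteq U$ and $1\le i\le n$, the Newton quotient $\Phi^{e_i}F$ is the function of $(z_1,\dots,z_{i-1},(s,t),z_{i+1},\dots,z_n)$, with all coordinates in the respective $x_k+\delta\mathcal O_1$ (and $s,t\in x_i+\delta\mathcal O_1$), $s\neq t$, given by $\big(F(z_1,\dots,s,\dots,z_n)-F(z_1,\dots,t,\dots,z_n)\big)/(s-t)$ ($s,t$ in the $i$th slot). $F$ is $C^1$ if it is continuous and, for every $i$ and every ball $x+\delta\mathcal O_n\subseteq U$, $\Phi^{e_i}F$ extends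 continuously across $s=t$. Then $D^{e_i}F(x)$ is the value of the extension at $z=x$, $s=t=x_i$, and $dF(x)$ is the matrix with columns $D^{e_i}F(x)$. $d\mathbf B(x)=(dB_j(x))_j$. For a tuple $\mathbf B=(B_j)$ of $C^1$ (or linear) maps with common domain $W\subseteq\mathbb K^n$ open, and nonnegative nonzero Schwartz--Bruhat functions $f_j$ on $\mathbb K^{n_j}$, $$\operatorname{BL}(\mathbf B,\mathbf c;\mathbf f)=\frac{\int_W\prod_{j}f_j^{c_j}\circ B_j}{\prod_j(\int f_j)^{c_j}},\qquad \operatorname{BL}(\mathbf B,\mathbf c)=\sup_{\mathbf f}\operatorname{BL}(\mathbf B,\mathbf c;\mathbf f)\in[0,+\infty].$$ Factors with exponent $c_j=0$ are identically $1$. For $\operatorname{BL}(d\mathbf B(x),\mathbf c)$ the domain of the linear maps $dB_j(x)$ is all of $\mathbb K^n$. *)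

(* Defs.v *)
From HB Require Import structures.
From mathcomp Require Import all_boot all_order all_algebra.
From mathcomp Require Import all_classical all_reals all_analysis.

Set Implicit Arguments.
Unset Strict Implicit.
Unset Printing Implicit Defensive.

Import Order.TTheory GRing.Theory Num.Theory.

Local Open Scope classical_set_scope.
Local Open Scope ring_scope.

Notation borel G := (g_sigma_algebraType (@open G)).

(* Regularity is not required: on the groups used below (K and K^k for a local
   field K), which are locally compact and second countable, it is automatic. *)
Definition haar_measure (R : realType) (G : ptopologicalType)
    (add : G -> G -> G)
    (nu : {measure set (borel G) -> \bar R}) : Prop :=
  [/\ forall (x : G) (A : set (borel G)), measurable A ->
        nu [set add x y | y in A] = nu A,
      forall C : set G, compact C -> (nu C < +oo)%E
    & forall V : set G, open V -> V !=set0 -> (0 < nu V)%E].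

#[short(type="fieldWithTopologyType")]
HB.structure Definition FieldWithTopology :=
  {K of GRing.Field K & Topological K}.

(* The library only puts the generated sigma-algebra on pointed types. *)
HB.instance Definition _ (K : fieldWithTopologyType) :=
  isPointed.Build K (0 : K).

Definition modular_function (R : realType) (K : fieldWithTopologyType)
    (absv : K -> R) : Prop :=
  exists2 nu : {measure set (borel K) -> \bar R},
    haar_measure (fun x y : K => x + y) nu &
    forall (a : K) (A : set (borel K)), a != 0 -> measurable A ->
      nu [set (a * y : K) | y in A] = ((absv a)%:E * nu A)%E.

(* Non-discrete non-Archimedean local fields, with the absolute value given by
   the modular function of Haar measure. The topology is the one of the metric
   |x - y|; in particular it is Hausdorff and the field operations are
   continuous. *)
HB.mixin Record FieldWithTopology_isNonArchLocal (R : realType) K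
    & FieldWithTopology K := {
  absv : K -> R ;
  absv_ge0 : forall x : K, 0 <= absv x ;
  absv_eq0 : forall x : K, (absv x == 0) = (x == 0) ;
  absvM : forall x y : K, absv (x * y) = absv x * absv y ;
  absv_ultrametric : forall x y : K,
    absv (x + y) <= Num.max (absv x) (absv y) ;
  nbhs_absv : forall x : K,
    nbhs x = filter_from [set e : R | 0 < e]
                         (fun e => [set y : K | absv (x - y) < e]) ;
  local_field_locally_compact : locally_compact [set: K] ;
  local_field_nondiscrete : ~ open [set (0 : K)] ;
  absv_modular : modular_function absv
}.

#[short(type="nonArchLocalFieldType")]
HB.structure Definition NonArchLocalField (R : realType) :=
  {K of FieldWithTopology K & FieldWithTopology_isNonArchLocal R K}.

HB.instance Definition _ (R : realType) (K : nonArchLocalFieldType R) :=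
  Pointed.copy K (FieldWithTopology.sort K).

Section Defs.
Variables (R : realType) (K : nonArchLocalFieldType R).

(* O_k *)
Definition unit_ball (k : nat) : set 'cV[K]_k :=
  [set y | forall i, absv (y i 0) <= 1].

(* x + h O_k *)
Definition cball (k : nat) (x : 'cV[K]_k) (h : K) : set 'cV[K]_k :=
  [set x + h *: y | y in @unit_ball k].

Definition normalized_haar (k : nat)
    (mu : {measure set (borel 'cV[K]_k) -> \bar R}) : Prop :=
  haar_measure (fun x y : 'cV[K]_k => x + y) mu /\ mu (@unit_ball k) = 1%E.

Definition schwartz_bruhat (k : nat) (f : 'cV[K]_k -> R) : Prop :=
  compact (closure [set x | f x != 0]) /\
  exists2 h : K, h != 0 &
    forall x y : 'cV[K]_k, unit_ball y -> f (x + h *: y) = f x.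

Section C1.
Variables (n l : nat).
Implicit Types (U : set 'cV[K]_n) (F : 'cV[K]_n -> 'cV[K]_l).

Definition replace_coord (z : 'cV[K]_n) (i : 'I_n) (t : K) : 'cV[K]_n :=
  \col_k (if k == i then t else z k 0).

(* The point (z_1, .., (s, t), .., z_n) is encoded as the pair (z, t), where
   s = z_i is the i-th coordinate of z. *)
Definition newton_quotient F (i : 'I_n) (zt : 'cV[K]_n * K) : 'cV[K]_l :=
  (zt.1 i 0 - zt.2)^-1 *: (F zt.1 - F (replace_coord zt.1 i zt.2)).

Definition newton_domain (x : 'cV[K]_n) (h : K) (i : 'I_n) :
    set ('cV[K]_n * K) :=
  [set zt | cball x h zt.1 /\
            exists2 u : K, absv u <= 1 & zt.2 = x i 0 + h * u].

Definition newton_extension F (x : 'cV[K]_n) (h : K) (i : 'I_n)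
    (G : 'cV[K]_n * K -> 'cV[K]_l) : Prop :=
  {within newton_domain x h i, continuous G} /\
  forall zt, newton_domain x h i zt -> zt.1 i 0 != zt.2 ->
    G zt = newton_quotient F i zt.

(* Maps defined on U are represented by total functions, of which only the
   values on U matter. *)
Definition C1 U F : Prop :=
  {within U, continuous F} /\
  forall (i : 'I_n) (x : 'cV[K]_n) (h : K), h != 0 -> cball x h `<=` U ->
    exists G, newton_extension F x h i G.

(* For F of class C^1 on the open set U and x in U, the set has exactly one
   element, as U contains a ball centred at x and s = t is in the closure of
   s <> t. *)
Definition partial_derivative U F (i : 'I_n) (x : 'cV[K]_n) : 'cV[K]_l :=
  xget 0 [set v | exists (h : K) (G : 'cV[K]_n * K -> 'cV[K]_l),
    [/\ h != 0, cball x h `<=` U, newton_extension F x h i G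
      & v = G (x, x i 0)]].

Definition differential U F (x : 'cV[K]_n) : 'M[K]_(l, n) :=
  \matrix_(k < l, i < n) partial_derivative U F i x k 0.

End C1.

Section BrascampLieb.
Variable mu : forall k : nat, {measure set (borel 'cV[K]_k) -> \bar R}.
Variables (n m : nat) (d : 'I_m -> nat).
Variables (W : set 'cV[K]_n) (B : forall j : 'I_m, 'cV[K]_n -> 'cV[K]_(d j)).
Variable c : 'I_m -> R.

(* Since 0 `^ 0 = 1, factors with zero exponent are identically 1. *)
Definition BL_quotient (f : forall j : 'I_m, 'cV[K]_(d j) -> R) : \bar R :=
  ((\int[mu n]_(x in W) (\prod_(j < m) (f j (B j x)) `^ (c j))%:E) /
   (\prod_(j < m) (\int[mu (d j)]_y f j y)%R `^ (c j))%:E)%E.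

Definition BL_input (f : forall j : 'I_m, 'cV[K]_(d j) -> R) : Prop :=
  forall j, [/\ schwartz_bruhat (f j), forall y, 0 <= f j y
              & exists y, f j y != 0].

Definition BL_constant : \bar R :=
  ereal_sup [set BL_quotient f | f in BL_input].

End BrascampLieb.
End Defs.

(* Main.v *)
(* Fix a point x of U and inputs f_j, and test the inequality for B on the
   rescaled inputs y |-> f_j (g^-1 (y - B_j x)) with g small. On a ball
   x + g r O_n, strict differentiability of B_j at x and the local constancy of
   f_j turn f_j (g^-1 (B_j (x + g v) - B_j x)) into exactly f_j (dB_j(x) v), so
   that no error term appears. Scaling costs the factor |g|^n in the numerator
   and |g|^(sum_j c_j n_j) in the denominator, and the dimension condition makes
   the quotient at least 1 when |g| <= 1. Monotone convergence in r concludes.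
   All integrands are locally constant, so the change of variables v |-> x + g v
   on a ball reduces to counting cosets of h O_k. *)
Require Import Defs.
From HB Require Import structures.
From mathcomp Require Import all_boot all_order all_algebra.
From mathcomp Require Import all_classical all_reals all_analysis.
From mathcomp Require Import measurable_realfun.

Set Implicit Arguments.
Unset Strict Implicit.
Unset Printing Implicit Defensive.

Import Order.TTheory GRing.Theory Num.Theory.

Local Open Scope classical_set_scope.
Local Open Scope ring_scope.

(** * The absolute value and the neighbourhoods it defines in [K] *)

Section AbsoluteValue.
Variables (R : realType) (K : nonArchLocalFieldType R).
Implicit Types (x y h : K).

Lemma absv_gt0 x : (0 < absv x) = (x != 0).
Proof. by rewrite lt_def absv_ge0 andbT absv_eq0. Qed.

Lemma absv0 : absv (0 : K) = 0.
Proof. by apply/eqP; rewrite absv_eq0. Qed.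

Lemma absv1 : absv (1 : K) = 1.
Proof.
have v1_neq0 : absv (1 : K) != 0 by rewrite absv_eq0 oner_neq0.
by apply: (mulfI v1_neq0); rewrite -absvM !mulr1.
Qed.

Lemma absvN x : absv (- x) = absv x.
Proof.
suff vN1 : absv (-1 : K) = 1 by rewrite -mulN1r absvM vN1 mul1r.
(* Both sides are nonnegative, so it suffices to compare squares. *)
apply/eqP; rewrite -(@eqrXn2 _ 2) ?absv_ge0 ?ler01//.
by rewrite expr2 -absvM mulrNN mulr1 absv1 expr1n.
Qed.

Lemma absv_distrC x y : absv (x - y) = absv (y - x).
Proof. by rewrite -absvN opprB. Qed.

Lemma absvV x : absv x^-1 = (absv x)^-1.
Proof.
have [->|x0] := eqVneq x 0; first by rewrite invr0 absv0 invr0.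
have vx0 : absv x != 0 by rewrite absv_eq0.
by apply: (mulfI vx0); rewrite -absvM !divff// absv1.
Qed.

Lemma absvX x k : absv (x ^+ k) = absv x ^+ k.
Proof. by elim: k => [|k IH]; rewrite ?expr0 ?absv1// !exprS absvM IH. Qed.

Lemma absv_le_add (e : R) x y : absv x <= e -> absv y <= e -> absv (x + y) <= e.
Proof.
by move=> xe ye; rewrite (le_trans (absv_ultrametric _ _))// ge_max xe.
Qed.

Lemma absv_le_sum (I : Type) (r : seq I) (P : pred I) (F : I -> K) (e : R) :
  0 <= e -> (forall i, P i -> absv (F i) <= e) ->
  absv (\sum_(i <- r | P i) F i) <= e.
Proof.
move=> e0 Fe; elim/big_ind : _ => //; first by rewrite absv0.
by move=> *; exact: absv_le_add.
Qed.

(** If no such [h] existed, the ball of radius [e] about 0 would be the single point 0, making it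
    open and [K] discrete. *)
Lemma exists_absv_lt (e : R) : 0 < e -> exists2 h : K, h != 0 & absv h < e.
Proof.
move=> e0; apply: contrapT => noh; apply: (@local_field_nondiscrete _ K).
rewrite openE => _ ->; rewrite /interior nbhs_absv; exists e => // y /=.
rewrite sub0r absvN => ye; apply: contrapT => /eqP y0; apply: noh.
by exists y.
Qed.

(** Serves to merge finitely many radii, one per coordinate or per index [j], into one. The minimum
    starts at 1 so that an empty family is covered. *)
Lemma exists_absv_le_family (I : finType) (r : I -> K) :
  (forall i, r i != 0) ->
  exists2 h : K, h != 0 & forall i, absv h <= absv (r i).
Proof.
move=> r0; have [|h h0 hr] := @exists_absv_lt (\big[Num.min/1]_i absv (r i)).
  elim/big_ind : _ => [//||i _]; first by move=> *; rewrite lt_min; apply/andP.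
  by rewrite absv_gt0.
exists h => // i; rewrite ltW// (lt_le_trans hr)//.
by rewrite (bigD1 i)//= ge_min lexx.
Qed.

Lemma exists_absv_le2 (r s : K) : r != 0 -> s != 0 ->
  exists h : K, [/\ h != 0, absv h <= absv r & absv h <= absv s].
Proof.
move=> r0 s0; have [|h h0 hrs] :=
    @exists_absv_le_family bool (fun b => if b then r else s); first by case.
by exists h; split=> //; [exact: (hrs true)|exact: (hrs false)].
Qed.

Lemma nbhs_absvP x (A : set K) :
  nbhs x A <->
  exists2 h : K, h != 0 & [set y | absv (y - x) <= absv h] `<=` A.
Proof.
rewrite nbhs_absv; split=> [[e/= e0 xeA]|[h h0 hA]].
  have [h h0 he] := exists_absv_lt e0; exists h => // y/= yx.
  by apply: xeA => /=; rewrite absv_distrC (le_lt_trans yx).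
exists (absv h); first by rewrite /= absv_gt0.
by move=> y /= /ltW; rewrite absv_distrC; exact: hA.
Qed.

End AbsoluteValue.

(** * Balls of [K^k]: ultrametric geometry and affine images *)

Section Balls.
Variables (R : realType) (K : nonArchLocalFieldType R) (k : nat).
Implicit Types (x y z : 'cV[K]_k) (h g : K).

Lemma cballP x h y :
  cball x h y <-> forall i, absv (y i 0 - x i 0) <= absv h.
Proof.
split=> [[u u1 <-] i|xy].
  by rewrite !mxE addrAC subrr add0r absvM ler_piMr ?absv_ge0.
(* For [h = 0] both sides say [y = x]; division by [h] works only in the other case. *)
have [h0|h0] := eqVneq h 0.
  exists 0 => [i|]; first by rewrite mxE absv0.
  rewrite scaler0 addr0; apply/matrixP => i j; rewrite ord1.
  apply/esym/eqP; rewrite -subr_eq0 -(@absv_eq0 R) eq_le absv_ge0 andbT.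
  by rewrite (le_trans (xy i))// h0 absv0.
exists (h^-1 *: (y - x)); last by rewrite scalerA divff// scale1r subrKC.
by move=> i; rewrite !mxE absvM absvV mulrC ler_pdivrMr ?mul1r ?absv_gt0.
Qed.

Lemma unit_ballE : @unit_ball R K k = cball 0 1.
Proof.
by apply/seteqP; split=> y; [move=> y1; apply/cballP|move=> /cballP y1] => i;
  have := y1 i; rewrite mxE subr0 absv1.
Qed.

Lemma cballxx x h : cball x h x.
Proof. by apply/cballP => i; rewrite subrr absv0 absv_ge0. Qed.

Lemma cball_trans x y z h : cball x h y -> cball y h z -> cball x h z.
Proof.
move=> /cballP xy /cballP yz; apply/cballP => i.
by rewrite -(subrKA (y i 0)) absv_le_add.
Qed.

Lemma le_cball x h g : absv h <= absv g -> cball x h `<=` cball x g.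
Proof. by move=> hg y /cballP xy; apply/cballP => i; exact: le_trans hg. Qed.

(** The topology of column vectors is the product topology, and the finitely many coordinate radii
    have a common nonzero lower bound. *)
Lemma nbhs_cballP x (A : set 'cV[K]_k) :
  nbhs x A <-> exists2 h : K, h != 0 & cball x h `<=` A.
Proof.
split=> [[P xP PA]|[h h0 hA]].
  have /choice[r rP] : forall i, exists h : K,
      h != 0 /\ [set y | absv (y - x i 0) <= absv h] `<=` P i 0.
    by move=> i; have /nbhs_absvP[h h0 hP] := xP i 0; exists h.
  have [|h h0 hr] := exists_absv_le_family (r := r) _.
    by move=> i; case: (rP i).
  exists h => // y /cballP xy; apply: PA => i j; rewrite ord1.
  by apply: (rP i).2 => /=; rewrite (le_trans (xy i)).
exists (fun i _ => [set y | absv (y - x i 0) <= absv h]).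
  by move=> i j; rewrite ord1; apply/nbhs_absvP; exists h.
by move=> y xy; apply: hA; apply/cballP => i; exact: xy.
Qed.

Lemma open_cball x h : h != 0 -> open (cball x h).
Proof.
move=> h0; rewrite openE => y xy; apply/nbhs_cballP; exists h => // z.
exact: cball_trans.
Qed.

Lemma measurable_cball x h : h != 0 ->
  measurable (cball x h : set (borel 'cV[K]_k)).
Proof. by move=> h0; apply: sub_sigma_algebra; exact: open_cball. Qed.

Lemma cball_affine x y h g : g != 0 ->
  cball (x + g *: y) (g * h) = [set x + g *: z | z in cball y h].
Proof.
move=> g0; apply/seteqP; split=> [z /cballP xz|_ [z /cballP yz <-]].
  exists (g^-1 *: (z - x)); last by rewrite scalerA divff// scale1r subrKC.
  apply/cballP => i; have := xz i; rewrite !mxE opprD addrA.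
  rewrite (_ : z i 0 - x i 0 - g * y i 0 =
               g * (g^-1 * (z i 0 - x i 0) - y i 0)); last first.
    by rewrite mulrBr mulrA divff// mul1r.
  by rewrite !absvM ler_pM2l ?absv_gt0.
apply/cballP => i; rewrite !mxE opprD addrACA subrr add0r -mulrBr !absvM.
by rewrite ler_pM2l ?absv_gt0.
Qed.

End Balls.

(** * Measures and integrals over finite disjoint unions *)

Section FiniteUnions.
Context {disp : measure_display} {T : measurableType disp} {R : realType}.
Variable mu : {measure set T -> \bar R}.
Variables (I : finType) (F : I -> set T).
Hypotheses (mF : forall i, measurable (F i)) (tF : trivIset setT F).

Lemma bigcup_fintype : \bigcup_i F i = \big[setU/set0]_(i <- enum I) F i.
Proof.
by rewrite -bigcup_seq; apply: eq_bigcupl; split=> i //= _; rewrite mem_enum.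
Qed.

Lemma measure_bigcup_fintype : mu (\bigcup_i F i) = (\sum_i mu (F i))%E.
Proof.
rewrite bigcup_fintype -bigcup_seq measure_fin_bigcup//.
- by rewrite -fsbig_seq ?enum_uniq// big_enum.
- by move=> i j _ _; exact: tF.
Qed.

Lemma ge0_integral_bigcup_fintype (f : T -> \bar R) :
  measurable_fun (\bigcup_i F i) f ->
  (forall x, (\bigcup_i F i) x -> (0 <= f x)%E) ->
  (\int[mu]_(x in \bigcup_i F i) f x = \sum_i \int[mu]_(x in F i) f x)%E.
Proof.
rewrite bigcup_fintype => mf f0; rewrite ge0_integral_bigsetU ?enum_uniq//.
- by rewrite big_enum.
- by move=> i j _ _; exact: tF.
Qed.

End FiniteUnions.

(** * Counting the cosets of [h O_1] in [O_1] by Haar measure *)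

Section CosetRepresentatives.
Variables (R : realType) (K : nonArchLocalFieldType R).

Let disc (x h : K) : set (borel K) := [set y : K | absv (y - x) <= absv h].

Let measurable_disc x h : h != 0 -> measurable (disc x h).
Proof.
move=> h0; apply: sub_sigma_algebra; rewrite /= openE => y xy.
apply/nbhs_absvP; exists h => // z /= yz; rewrite /disc /= -(subrKA (y : K)).
exact: absv_le_add.
Qed.

Let finite_disc :
  exists2 nu : {measure set (borel K) -> \bar R},
    (forall x h, h != 0 ->
       nu (disc x h) = ((absv h)%:E * nu (disc 0%R 1%R))%E) &
    exists2 r : R, 0 < r & nu (disc 0 1) = r%:E.
Proof.
have [nu [nuD nu_compact nu_open] nuM] := @absv_modular R K.
have scale_disc h : h != 0 -> [set (h * y : K) | y in disc 0 1] = disc 0 h.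
  move=> h0; apply/seteqP; split=> [_ [y + <-]|y]; rewrite /disc/= !subr0.
    by rewrite absv1 => y1; rewrite absvM ler_piMr ?absv_ge0.
  move=> yh; exists (h^-1 * y); last by rewrite mulrA divff ?mul1r.
  by rewrite subr0 absv1 absvM absvV mulrC ler_pdivrMr ?mul1r ?absv_gt0.
have translate_disc x h : [set x + y | y in disc 0 h] = disc x h.
  apply/seteqP; split=> [_ [y + <-]|y]; rewrite /disc/=.
    by rewrite subr0 addrAC subrr add0r.
  by move=> xy; exists (y - x); rewrite ?subr0// subrKC.
have nu_disc x h : h != 0 ->
    nu (disc x h) = ((absv h)%:E * nu (disc 0%R 1%R))%E.
  move=> h0; rewrite -translate_disc nuD; last exact: measurable_disc.
  by rewrite -scale_disc// nuM//; apply: measurable_disc; exact: oner_neq0.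
exists nu => //.
have nu1_gt0 : (0 < nu (disc 0%R 1%R))%E.
  apply: nu_open; last by exists 0; rewrite /disc/= subrr absv0 absv_ge0.
  rewrite openE => y y1; apply/nbhs_absvP; exists 1; first exact: oner_neq0.
  by move=> z /= yz; rewrite /disc/= -(subrKA (y : K)); exact: absv_le_add.
(* Local compactness gives a compact neighbourhood of 0, hence some disc [h O_1] of finite measure;
   the factor [|h|] then carries finiteness over to [O_1]. *)
have [C + [cptC clC]] := @local_field_locally_compact R K 0 I.
rewrite /= /within/= => /nbhs_absvP[h h0 hC].
have : (nu (disc 0%R h) < +oo)%E.
  apply: (@le_lt_trans _ _ (nu C)); last exact: nu_compact.
  apply: le_measure; rewrite ?inE//.
  - exact: measurable_disc.
  - rewrite -(setCK C); apply: measurableC; apply: sub_sigma_algebra.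
    exact: closed_openC.
  - by move=> y hy; apply: hC.
rewrite nu_disc//.
case: (nu (disc 0 1)) nu1_gt0 => [r|_|//]; first by move=> r0 _; exists r.
by rewrite gt0_muley// lte_fin absv_gt0.
Qed.

(* The last clause, [O_1 : h O_1] = 1 / |h|, holds because |.| is the modular
   function. *)
Lemma exists_coset_representatives (h : K) : h != 0 -> absv h <= 1 ->
  exists (N : nat) (a : 'I_N -> K),
    [/\ forall i, absv (a i) <= 1,
        forall i j, absv (a i - a j) <= absv h -> i = j,
        forall y, absv y <= 1 -> exists i, absv (y - a i) <= absv h
      & N%:R * absv h = 1].
Proof.
move=> h0 h1; have [nu nu_disc [r r0 nu1]] := finite_disc.
pose separated N (a : 'I_N -> K) := (forall i, absv (a i) <= 1) /\
  forall i j, absv (a i - a j) <= absv h -> i = j.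
have nu_sep N (a : 'I_N -> K) : separated N a ->
    nu (\bigcup_i disc (a i) h) = (N%:R * absv h * r)%:E.
  move=> [a1 a_sep]; rewrite measure_bigcup_fintype; first 1 last.
  - by move=> i; exact: measurable_disc.
  - move=> i j _ _ [y [/= iy jy]]; apply: a_sep.
    by rewrite -(subrKA y) absv_le_add// absv_distrC.
  under eq_bigr do rewrite nu_disc// nu1 -EFinM.
  by rewrite sumEFin sumr_const card_ord -mulrA mulr_natl.
have sub_sep N (a : 'I_N -> K) : separated N a ->
    \bigcup_i disc (a i) h `<=` disc 0 1.
  move=> [a1 _] y [i _]; rewrite /disc/= subr0 absv1 => iy.
  by rewrite -(subrK (a i) y) absv_le_add// (le_trans iy).
have sep_le N (a : 'I_N -> K) : separated N a -> N%:R * absv h <= 1.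
  move=> sepa; rewrite -(ler_pM2r r0) mul1r -lee_fin -nu1 -(nu_sep _ _ sepa).
  apply: le_measure; rewrite ?inE//; last exact: sub_sep.
  - by rewrite bigcup_fintype; apply: bigsetU_measurable => i _;
      exact: measurable_disc.
  - by apply: measurable_disc; exact: oner_neq0.
(* The [N] disjoint discs of a separated family lie in [O_1], so [N <= 1 / |h|] and a family of
   maximal size exists. *)
pose P N := `[< exists a, separated N a >].
have P0 : exists N, P N.
  by exists 0%N; apply/asboolP; exists (fun=> 0); split=> -[].
have PB N : P N -> (N <= Num.truncn (absv h)^-1)%N.
  move=> /asboolP[a /sep_le]; rewrite -ler_pdivlMr ?absv_gt0// mul1r => Nh.
  by rewrite truncn_ge_nat// invr_ge0 absv_ge0.
case: (ex_maxnP P0 PB) => N /asboolP[a sepa] maxN; exists N, a.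
have cover_a y : absv y <= 1 -> exists i, absv (y - a i) <= absv h.
  move=> y1; apply: contrapT => noi.
  (* A point outside all the discs could be added to the family, against maximality. *)
  suff : P N.+1 by move=> /maxN; rewrite ltnn.
  apply/asboolP.
  exists (fun i => if unlift ord0 i is Some j then a j else y); split=> [i|i j].
    by case: unliftP => // j _; exact: sepa.1.
  case: unliftP => [i' ->|->]; case: unliftP => [j' ->|->]//.
  - by move=> /sepa.2 ->.
  - by rewrite absv_distrC => yi; exfalso; apply: noi; exists i'.
  - by move=> yj; exfalso; apply: noi; exists j'.
split => //; [exact: sepa.1|exact: sepa.2|].
(* The discs of the maximal family are disjoint and fill [O_1], so [N |h| r = r]. *)
apply: (mulIf (lt0r_neq0 r0)); rewrite mul1r; apply: EFin_inj.
rewrite -(nu_sep _ _ sepa) -nu1; congr (nu _).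
apply/seteqP; split; first exact: sub_sep.
move=> y; rewrite /disc/= subr0 absv1 => /cover_a[i iy]; by exists i.
Qed.

End CosetRepresentatives.

(** * Partitions of balls into smaller balls; locally constant functions *)

Section BallPartition.
Variables (R : realType) (K : nonArchLocalFieldType R) (k : nat).
Implicit Types (x y : 'cV[K]_k) (h g : K).

(** The centres [s] are the vectors whose entries are coset representatives of [h O_1] in [O_1],
    which gives [|h|^-k] of them. The same family, moved by [y -> x + g y], partitions every
    ball. *)
Lemma cball_partition h : h != 0 -> absv h <= 1 ->
  exists (I : finType) (s : I -> 'cV[K]_k),
    [/\ #|I|%:R * absv h ^+ k = 1,
        forall i, unit_ball (s i)
      & forall x g, g != 0 ->
          cball x g = \bigcup_i cball (x + g *: s i) (g * h) /\
          trivIset setT (fun i => cball (x + g *: s i) (g * h))].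
Proof.
move=> h0 h1; have [N [a [a1 a_sep a_cover Nh]]] :=
  exists_coset_representatives h0 h1.
pose s (t : {ffun 'I_k -> 'I_N}) : 'cV[K]_k := \col_i a (t i).
exists {ffun 'I_k -> 'I_N}, s; split=> [|t i|x g g0].
- by rewrite card_ffun !card_ord natrX -exprMn Nh expr1n.
- by rewrite mxE.
split; last first.
  move=> t t' _ _ [y []]; rewrite !cball_affine// => -[z /cballP tz <-].
  move=> [z' /cballP tz' /addrI /(scalerI g0) zz']; apply/ffunP => i.
  apply: a_sep; rewrite -(subrKA (z i 0)) absv_le_add//.
    by have := tz i; rewrite mxE absv_distrC.
  by have := tz' i; rewrite zz' mxE.
apply/seteqP; split=> [_ [y y1 <-]|y [t _]].
  have /choice[t tP] : forall i, exists j, absv (y i 0 - a j) <= absv h.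
    by move=> i; exact: a_cover.
  exists (finfun t) => //; rewrite cball_affine//; exists y => //.
  by apply/cballP => i; rewrite mxE ffunE.
rewrite cball_affine// => -[z /cballP tz <-]; exists z => // i.
rewrite -(subrK (s t i 0) (z i 0)) absv_le_add ?mxE//.
by have := tz i; rewrite mxE => /le_trans; apply.
Qed.

(** The preimage of any set is a union of balls inside [D], hence open. *)
Lemma measurable_fun_locally_constant d (T : measurableType d)
    (D : set (borel 'cV[K]_k)) (F : 'cV[K]_k -> T) :
  (forall x, D x -> exists h : K, [/\ h != 0, cball x h `<=` D &
                                  forall y, cball x h y -> F y = F x]) ->
  measurable_fun D (F : borel 'cV[K]_k -> T).
Proof.
move=> lcF _ Y mY; apply: sub_sigma_algebra.
rewrite /= openE => x [/lcF[h [h0 hD hF]] FxY].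
apply/nbhs_cballP; exists h => // y hy; split; first exact: hD.
by rewrite /= hF.
Qed.

End BallPartition.

(** * Haar measure of balls and affine change of variables *)

Section HaarIntegrals.
Variables (R : realType) (K : nonArchLocalFieldType R) (k : nat).
Variable mu : {measure set (borel 'cV[K]_k) -> \bar R}.
Hypothesis mu_haar : normalized_haar mu.
Implicit Types (x y : 'cV[K]_k) (h g r p : K).

(** By translation invariance, splitting a ball into congruent smaller ones determines the ratio of
    their measures; [O_k] has measure 1. *)
Lemma normalized_haar_cball x h : h != 0 ->
  mu (cball x h) = (absv h ^+ k)%:E.
Proof.
have [[muD _ _] mu1] := mu_haar.
have mu_translate y g : g != 0 -> mu (cball y g) = mu (cball 0%R g).
  move=> g0; rewrite -(muD y (cball 0 g)); last exact: measurable_cball.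
  congr (mu _); apply/seteqP; split=> [_ [u u1 <-]|_ [_ [u u1 <-] <-]].
    by exists (g *: u) => //; exists u; rewrite ?add0r.
  by exists u; rewrite ?add0r.
have mu_index g e : g != 0 -> e != 0 -> absv e <= 1 ->
    exists2 N : R, N * absv e ^+ k = 1 &
                   mu (cball 0%R g) = (N%:E * mu (cball 0%R (g * e)%R))%E.
  move=> g0 e0 e1; have ge0 : g * e != 0 by rewrite mulf_neq0.
  have [I [s [Ie _ sP]]] :=
    cball_partition k e0 e1.
  exists #|I|%:R => //; have [-> tI] := sP 0 g g0.
  rewrite measure_bigcup_fintype//; last by move=> i; exact: measurable_cball.
  under eq_bigr do rewrite mu_translate//.
  by rewrite mule_natl sumr_const.
move=> h0; rewrite mu_translate//.
have hk0 : absv h ^+ k != 0 by rewrite expf_neq0// absv_eq0.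
have [h1|h1] := leP (absv h) 1.
  have [N Nh] := mu_index 1 h (oner_neq0 _) h0 h1.
  rewrite -unit_ballE mu1 mul1r => muh.
  by rewrite -[LHS]mul1e -Nh mulrC EFinM -muleA -muh mule1.
(* For [|h| > 1] the roles are exchanged: [h O_k] is cut into translates of [O_k]. *)
have [||N] := mu_index h h^-1 h0.
- by rewrite invr_eq0.
- by rewrite absvV invf_le1 ?ltW// absv_gt0.
rewrite divff// -unit_ballE mu1 mule1 => + ->.
rewrite absvV exprVn => /(congr1 ( *%R^~ (absv h ^+ k))).
by rewrite mulfVK// mul1r => ->.
Qed.

(** Both integrals are finite sums over matching partitions. Corresponding pieces carry the same
    value, and their measures differ by the factor [|g|^k]. *)
Lemma integral_cball_scale (F G : 'cV[K]_k -> R) x g r h :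
  g != 0 -> r != 0 -> h != 0 -> (forall y, 0 <= G y) ->
  (forall y z, cball y h z -> G z = G y) ->
  (forall y, cball 0 r y -> F (x + g *: y) = G y) ->
  (\int[mu]_(y in cball x (g * r)%R) (F y)%:E =
   (absv g ^+ k)%:E * \int[mu]_(y in cball 0%R r) (G y)%:E)%E.
Proof.
move=> g0 r0 h0 G0 hG FG.
(* The pieces of [r O_k] are to have radius [h' = r q]: [|h'| <= |r|] makes the partition available,
   [|h'| <= |h|] makes [G] constant on each piece. *)
have [h' [h'0 h'h h'r]] := exists_absv_le2 h0 r0.
pose q := h' / r.
have q0 : q != 0 by rewrite mulf_neq0// invr_eq0.
have rq : r * q = h' by rewrite mulrC divfK.
have q1 : absv q <= 1 by rewrite absvM absvV ler_pdivrMr ?mul1r ?absv_gt0.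
have [I [s [_ s1 sP]]] := cball_partition k q0 q1.
have step (H : 'cV[K]_k -> R) y e : e != 0 ->
    (forall z, cball y e z -> 0 <= H z) ->
    (forall i z, cball (y + e *: s i) (e * q) z -> H z = H (y + e *: s i)) ->
    (\int[mu]_(z in cball y e) (H z)%:E =
     \sum_i (H (y + e *: s i)%R * absv (e * q)%R ^+ k)%:E)%E.
  move=> e0 H0 Hc; have [Ee tE] := sP y e e0.
  have eq0 : e * q != 0 by rewrite mulf_neq0.
  rewrite Ee ge0_integral_bigcup_fintype//.
  - apply: eq_bigr => i _.
    under eq_integral => z /set_mem iz do rewrite (Hc i z iz).
    by rewrite integral_cst ?normalized_haar_cball//; exact: measurable_cball.
  - by move=> i; exact: measurable_cball.
  - apply: measurable_fun_locally_constant => z [i _ iz].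
    exists (e * q); split=> // [w zw|w zw].
      by exists i => //; exact: cball_trans zw.
    by rewrite (Hc i w) ?(Hc i z)//; exact: cball_trans zw.
  - by rewrite -Ee => z yz; rewrite lee_fin H0.
(* Piece [i] of [x + g r O_k] is the image of piece [i] of [r O_k] under [y -> x + g y], so [F] has
   there the value of [G] at the centre [r s_i]. *)
have FG' i z : cball (x + (g * r) *: s i) (g * r * q) z ->
    F z = G (r *: s i) /\ 0 <= F z.
  rewrite -mulrA rq -scalerA cball_affine// => -[y iy <-].
  rewrite FG; last first.
    apply: (@cball_trans _ _ _ _ (r *: s i)); last exact: le_cball iy.
    by exists (s i) => //; rewrite add0r.
  by split=> //; apply: hG; exact: le_cball iy.
rewrite step; first last.
- by move=> i z iz; rewrite (FG' i z iz).1 (FG' i _ (cballxx _ _)).1.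
- move=> z; have [-> _] := sP x (g * r) (mulf_neq0 g0 r0).
  by move=> [i _ /FG'[]].
- exact: mulf_neq0.
rewrite (step G)//; last first.
  by move=> i z; rewrite rq => iz; apply: hG; exact: le_cball iz.
rewrite !sumEFin -EFinM mulr_sumr; congr EFin; apply: eq_bigr => i _.
rewrite (FG' i _ (cballxx _ _)).1 add0r -mulrA absvM exprMn mulrCA.
by congr (_ * _); rewrite mulrC.
Qed.

(** Since [|p| < 1], the balls increase to the whole space, and monotone convergence applies. *)
Lemma integral_cball_cvg (F : 'cV[K]_k -> R) x g p : g != 0 -> p != 0 ->
  absv p < 1 -> (forall y, 0 <= F y) ->
  measurable_fun setT (EFin \o F : borel 'cV[K]_k -> \bar R) ->
  (\int[mu]_(y in cball x (g * p ^- i)%R) (F y)%:E @[i --> \oo] -->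
   \int[mu]_y (F y)%:E)%E.
Proof.
move=> g0 p0 p1 F0 mF.
have gp0 i : g * p ^- i != 0 by rewrite mulf_neq0// invr_eq0 expf_neq0.
have -> : [set: 'cV[K]_k] = \bigcup_i cball x (g * p ^- i).
  apply/seteqP; split=> // y _.
  pose M := \sum_(i < k) absv (y i 0 - x i 0).
  have M0 : 0 <= M by apply: sumr_ge0 => i _; exact: absv_ge0.
  (* [M] bounds every coordinate of [y - x]; the 1 added to it keeps the divisor positive when
     [y = x]. *)
  have /cvgrPdist_lt/(_ (absv g / (M + 1)))[] : absv p ^+ n @[n --> \oo] --> 0.
    by apply: cvg_expr; rewrite ger0_norm ?absv_ge0.
  - by rewrite divr_gt0 ?absv_gt0// ltr_wpDl.
  move=> n _ /(_ n (leqnn _)).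
  rewrite sub0r normrN ger0_norm ?exprn_ge0 ?absv_ge0//.
  rewrite ltr_pdivlMr ?ltr_wpDl// => Mn; exists n => //; apply/cballP => i.
  rewrite absvM absvV absvX ler_pdivlMr ?exprn_gt0 ?absv_gt0//.
  apply: le_trans (ltW Mn); rewrite mulrC ler_wpM2l ?exprn_ge0 ?absv_ge0//.
  rewrite ler_wpDr// /M (bigD1 i)//= ler_wpDr// sumr_ge0// => j _.
  exact: absv_ge0.
apply: ge0_nondecreasing_set_cvg_integral => [|i|i|i y _].
- apply/nondecreasing_seqP => i; rewrite subsetEset; apply: le_cball.
  rewrite !absvM ler_pM2l ?absv_gt0// !absvV !absvX.
  rewrite lef_pV2 ?posrE ?exprn_gt0 ?absv_gt0//.
  by rewrite exprS ler_piMl ?exprn_ge0 ?absv_ge0// ltW.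
- exact: measurable_cball.
- exact: measurable_funS mF.
- by rewrite lee_fin.
Qed.

(** The limit of [integral_cball_scale] along the exhausting balls [p^-i O_k] and their images under
    [y -> x + g y]. *)
Lemma integral_affine (F G : 'cV[K]_k -> R) x g h : g != 0 -> h != 0 ->
  (forall y, 0 <= G y) ->
  (forall y z, cball y h z -> G z = G y) ->
  (forall y, F (x + g *: y) = G y) ->
  (\int[mu]_y (F y)%:E = (absv g ^+ k)%:E * \int[mu]_y (G y)%:E)%E.
Proof.
move=> g0 h0 G0 hG FG.
have FE y : F y = G (g^-1 *: (y - x)).
  by rewrite -FG scalerA divff// scale1r subrKC.
have F0 y : 0 <= F y by rewrite FE.
have [p p0 p1] := @exists_absv_lt R K 1 ltr01.
have mF : measurable_fun setT (EFin \o F : borel 'cV[K]_k -> \bar R).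
  apply: measurable_fun_locally_constant => y _; exists (g * h).
  split=> // [|z]; first exact: mulf_neq0.
  rewrite -(subrKC x y) -[y - x](scalerKV g0).
  by rewrite cball_affine// => -[w yw <-]; rewrite /= !FG (hG _ _ yw).
have mG : measurable_fun setT (EFin \o G : borel 'cV[K]_k -> \bar R).
  apply: measurable_fun_locally_constant => y _; exists h.
  by split=> // z /hG /= ->.
have cF := integral_cball_cvg x g0 p0 p1 F0 mF.
have cG := integral_cball_cvg 0 (oner_neq0 K) p0 p1 G0 mG.
apply: cvg_unique cF _ => //; rewrite [X in X @ _](_ : _ = fun i =>
    ((absv g ^+ k)%:E * \int[mu]_(y in cball 0%R (1 * p ^- i)%R) (G y)%:E)%E).
  exact: cvgeZl.
apply/funext => i; rewrite mul1r (@integral_cball_scale F G x g _ h)//.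
by rewrite invr_eq0 expf_neq0.
Qed.

End HaarIntegrals.

(** * First-order approximation of [C^1] maps *)

Section Differentiability.
Variables (R : realType) (K : nonArchLocalFieldType R) (n l : nat).
Implicit Types (U : set 'cV[K]_n) (F : 'cV[K]_n -> 'cV[K]_l) (x z w : 'cV[K]_n).

(** Continuity of the extended Newton quotient at [(x, x_i)], taken jointly in all coordinates,
    makes the estimate uniform in the coordinates of [z] other than the [i]th. *)
Lemma partial_derivative_approx U F x (i : 'I_n) (e : R) :
  open U -> C1 U F -> U x -> 0 < e ->
  exists2 h : K, h != 0 & forall z, cball x h z -> forall j,
    absv ((F z - F (replace_coord z i (x i 0))
           - (z i 0 - x i 0) *: partial_derivative U F i x) j 0)
    <= absv (z i 0 - x i 0) * e.
Proof.
move=> oU [_ C1F] Ux e0.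
have [h0 h00 xh0] : exists2 h : K, h != 0 & cball x h `<=` U.
  by apply/nbhs_cballP; move: oU; rewrite openE => /(_ x Ux).
(* The value selected by [xget] comes with its own radius [h] and extension [G]; the argument works
   with these. *)
have [|h [G [hn0 hU [Gcont Gquot] pdE]]] := @xgetPex _ 0
    [set v | exists (h : K) (G : 'cV[K]_n * K -> 'cV[K]_l),
    [/\ h != 0, cball x h `<=` U, newton_extension F x h i G
      & v = G (x, x i 0)]].
  have [G GF] := C1F i x h0 h00 xh0.
  by exists (G (x, x i 0)), h0, G.
rewrite -/(partial_derivative U F i x) in pdE.
have dom z : cball x h z -> newton_domain x h i (z, x i 0).
  by move=> hz; split => //; exists 0; rewrite ?absv0 ?ler01// mulr0 addr0.
have [e' e'0 e'e] := @exists_absv_lt R K e e0.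
have : nbhs (G (x, x i 0)) (cball (G (x, x i 0)) e').
  by apply/nbhs_cballP; exists e'.
move/subspace_continuousP : Gcont => /(_ _ (dom x (cballxx x h))) /[apply].
rewrite /= /within/= => -[[P Q] [/= /nbhs_cballP[r r0 rP] xiQ] PQ].
have [g [g0 gh gr]] := exists_absv_le2 hn0 r0.
exists g => // z gz j.
have hz : cball x h z := le_cball gh gz.
have [zx|zx] := eqVneq (z i 0) (x i 0).
  rewrite (_ : replace_coord _ _ _ = z).
    by rewrite zx !subrr scale0r subr0 mxE absv0 mul0r.
  apply/matrixP => a b; rewrite mxE ord1.
  by case: eqP => // ->.
have /cballP : cball (G (x, x i 0)) e' (G (z, x i 0)).
  apply: PQ; last exact: dom.
  by split; [apply: rP; exact: le_cball gz|exact: nbhs_singleton].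
rewrite (Gquot (z, x i 0))//; last exact: dom.
rewrite pdE /newton_quotient /= => /(_ j); rewrite -subr_eq0 in zx.
set D := F z - _; set v := G _ => vD.
rewrite -[D](scalerKV zx) -scalerBr mxE absvM.
rewrite ler_wpM2l ?absv_ge0//; apply: le_trans (ltW e'e).
by move: vD; rewrite !mxE.
Qed.

(** The increment telescopes into one-coordinate increments. By the ultrametric inequality their
    errors do not accumulate, so no factor [n] appears. *)
Lemma C1_differentiable U F x (e : R) :
  open U -> C1 U F -> U x -> 0 < e ->
  exists2 h : K, h != 0 & forall (g : K) w, absv g <= absv h ->
    cball 0 g w -> forall j,
      absv ((F (x + w) - F x - differential U F x *m w) j 0) <= absv g * e.
Proof.
move=> oU C1F Ux e0.
have /choice[r rP] : forall i : 'I_n, exists h : K, h != 0 /\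
    forall z, cball x h z -> forall j,
    absv ((F z - F (replace_coord z i (x i 0))
           - (z i 0 - x i 0) *: partial_derivative U F i x) j 0)
    <= absv (z i 0 - x i 0) * e.
  move=> i; have [h h0 hP] := partial_derivative_approx i oU C1F Ux e0.
  by exists h.
have [|h h0 hr] := exists_absv_le_family (r := r) _.
  by move=> i; case: (rP i).
exists h => // g w gh /cballP gw j.
have {}gw i : absv (w i 0) <= absv g by have := gw i; rewrite mxE subr0.
(* The path from x to x + w that changes one coordinate at a time. *)
pose p (i : nat) : 'cV[K]_n :=
  \col_(a < n) (x a 0 + if (a < i)%N then w a 0 else 0).
have p0 : p 0 = x by apply/matrixP => a b; rewrite ord1 mxE addr0.
have pn : p n = x + w by apply/matrixP => a b; rewrite ord1 !mxE ltn_ord.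
have pS (i : 'I_n) : replace_coord (p i.+1) i (x i 0) = p i.
  apply/matrixP => a b; rewrite !mxE ltnS leq_eqVlt.
  have [->|ai] := eqVneq a i.
    by rewrite ltnn addr0.
  by rewrite (negPf (ai : (a : nat) != i)).
have pi (i : 'I_n) : p i.+1 i 0 - x i 0 = w i 0.
  by rewrite mxE ltnSn addrAC subrr add0r.
have -> : F (x + w) - F x - differential U F x *m w =
    \sum_(i < n) (F (p i.+1) - F (p i) - w i 0 *: partial_derivative U F i x).
  rewrite sumrB -pn -(big_mkord xpredT (fun i => F (p i.+1) - F (p i))).
  rewrite telescope_sumr// p0; congr (_ - _).
  apply/matrixP => a b; rewrite ord1 !mxE summxE; apply: eq_bigr => i _.
  by rewrite !mxE mulrC.
rewrite summxE; apply: absv_le_sum; first by rewrite mulr_ge0 ?absv_ge0 ?ltW.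
(* The intermediate points stay in [x + r_i O_n], since each coordinate moves by 0 or by an entry of
   [w]. *)
move=> i _; rewrite -pS -pi (le_trans ((rP i).2 _ _ j))//.
  apply/cballP => a; rewrite mxE addrAC subrr add0r.
  apply: le_trans (hr i).
  by case: ifP => _; rewrite ?absv0 ?absv_ge0// (le_trans (gw a)).
by rewrite pi ler_wpM2r// ltW.
Qed.

End Differentiability.

(** * Inequalities and limits for extended real quotients *)

Section ExtendedRealQuotients.
Variable R : realType.
Local Open Scope ereal_scope.

(* Division by a zero [D] gives [+oo] (or [0] for a zero numerator), which the
   two lemmas below tolerate. *)
Lemma lee_div_scale (x : \bar R) (a b D : R) :
  0 <= x -> (0 < b)%R -> (b <= a)%R -> (0 <= D)%R ->
  x / D%:E <= (a%:E * x) / (b * D)%:E.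
Proof.
move=> x0 b0 ba D0; have a0 : (0 < a)%R by exact: lt_le_trans ba.
have [->|Dn0] := eqVneq D 0%R.
  rewrite mulr0 inve0; have [->|xn0] := eqVneq x 0; first by rewrite mule0.
  have x_gt0 : 0 < x by rewrite lt0e xn0.
  by rewrite !gt0_muley// mule_gt0.
rewrite !inver mulf_eq0 (gt_eqF b0) (negPf Dn0)/= invfM EFinM.
rewrite muleACA -EFinM.
apply: lee_pemull; last by rewrite lee_fin ler_pdivlMr ?mul1r.
by rewrite mule_ge0// lee_fin invr_ge0.
Qed.

Lemma cvg_div_le (u : (\bar R)^nat) (l C : \bar R) (D : R) :
  u @ \oo --> l -> (forall i, 0 <= u i) -> (0 <= D)%R ->
  (forall i, u i / D%:E <= C) -> l / D%:E <= C.
Proof.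
move=> ul u0 D0 uC; have [DE|Dn0] := eqVneq D 0%R; last first.
  apply: (@cvge_to_le _ \oo _ _ (fun i => u i / D%:E)); last exact: nearW.
  by apply: cvgeZr ul; rewrite inver (negPf Dn0).
rewrite DE inve0 in uC *.
(* With [D = 0], either all [u i] vanish and so does [l], or some quotient is [+oo] and forces
   [C = +oo]. *)
have [ui0|] := pselect (forall i, u i = 0).
  have -> : l = 0.
    by apply: cvg_unique ul _ => //; rewrite (funext ui0); exact: cvg_cst.
  by have := uC 0%N; rewrite ui0 !mul0e.
move=> /existsNP[i /eqP ui0].
have := uC i; rewrite gt0_muley ?lt0e ?ui0 ?u0// leye_eq => /eqP ->.
exact: leey.
Qed.

End ExtendedRealQuotients.

(** * Affine rescaling of Schwartz-Bruhat functions *)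

Section SchwartzBruhat.
Variables (R : realType) (K : nonArchLocalFieldType R) (k : nat).
Implicit Types (f : 'cV[K]_k -> R) (x y z : 'cV[K]_k) (g h : K).

(** The zero set is a union of balls. Hence the closure in [schwartz_bruhat] adds no points. *)
Lemma closed_support f h : h != 0 ->
  (forall y z, cball y h z -> f z = f y) -> closed [set y | f y != 0].
Proof.
move=> h0 hf; rewrite -[X in closed X]setCK; apply: open_closedC.
rewrite openE => y /= /negP; rewrite negbK => /eqP fy.
by apply/nbhs_cballP; exists h => // z /hf; rewrite /= fy => ->; rewrite eqxx.
Qed.

Lemma continuous_affine x g : continuous (fun y : 'cV[K]_k => x + g *: y).
Proof.
move=> y A /nbhs_cballP[h h0 hA]; apply/nbhs_cballP.
have [g0|g0] := eqVneq g 0.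
  exists 1 => [|z _ /=]; first exact: oner_neq0.
  by apply: hA; rewrite /= g0 !scale0r; exact: cballxx.
exists (h / g) => [|z yz]; first by rewrite mulf_neq0// invr_eq0.
by apply: hA; rewrite -[h](divfK g0) mulrC cball_affine//; exists z.
Qed.

Lemma schwartz_bruhat_cball f : schwartz_bruhat f ->
  exists2 h : K, h != 0 & forall y z, cball y h z -> f z = f y.
Proof. by move=> [_ [h h0 hf]]; exists h => // y _ [u u1 <-]; exact: hf. Qed.

(** The new support is the image of the old one under the continuous map [y -> x + g y], and the
    invariance radius [h] becomes [g h]. *)
Lemma schwartz_bruhat_affine f x g : g != 0 ->
  schwartz_bruhat f -> schwartz_bruhat (fun y => f (g^-1 *: (y - x))).
Proof.
move=> g0 sbf; have [h h0 hf] := schwartz_bruhat_cball sbf.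
have hf' y z : cball y (g * h) z ->
    f (g^-1 *: (z - x)) = f (g^-1 *: (y - x)).
  rewrite -(subrKC x y) -[y - x](scalerKV g0) cball_affine// => -[w yw <-].
  have cancel v : x + v - x = v by rewrite addrAC subrr add0r.
  by rewrite !cancel !scalerK// (hf _ _ yw).
have gh0 : g * h != 0 by exact: mulf_neq0.
split; last by exists (g * h) => // y u u1; apply: hf'; exists u.
have /closure_id <- := closed_support gh0 hf'.
have [+ _] := sbf; have /closure_id <- := closed_support h0 hf.
move=> cf; rewrite (_ : [set _ | _] =
    [set x + g *: y | y in [set y | f y != 0]]).
  apply: continuous_compact cf; apply: continuous_subspaceT.
  exact: continuous_affine.
apply/seteqP; split=> [y fy|_ [y fy <-]].
  by exists (g^-1 *: (y - x)) => //; rewrite scalerKV// subrKC.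
by rewrite /= addrAC subrr add0r scalerK.
Qed.

End SchwartzBruhat.

(** * Continuity of linear maps at 0 *)

Section Linearization.
Variables (R : realType) (K : nonArchLocalFieldType R).

Lemma mulmx_cball (n l : nat) (A : 'M[K]_(l, n)) (e : K) : e != 0 ->
  exists2 h : K, h != 0 & forall w, cball 0 h w -> cball 0 e (A *m w).
Proof.
move=> e0.
(* [|a|] is at most [1 / |A_ij|] for each nonzero entry; zero entries get the placeholder 1. *)
have [|a a0 aA] := @exists_absv_le_family R K ('I_l * 'I_n)%type
    (fun ij => if A ij.1 ij.2 == 0 then 1 else (A ij.1 ij.2)^-1).
  by move=> ij /=; case: (A _ _ =P 0) => [_|/eqP]; rewrite ?oner_neq0 ?invr_eq0.
exists (e * a) => [|w /cballP ew]; first exact: mulf_neq0.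
apply/cballP => i; rewrite !mxE subr0 absv_le_sum ?absv_ge0// => j _.
have := ew j; rewrite mxE subr0 !absvM => wj.
have := aA (i, j); rewrite /=; case: eqP => [->|/eqP Aij] aij.
  by rewrite absv0 mul0r absv_ge0.
rewrite absvV in aij; rewrite -ler_pdivlMl ?absv_gt0//.
by rewrite (le_trans wj)// mulrC ler_wpM2r ?absv_ge0.
Qed.

End Linearization.

(** * Rescaled inputs and comparison of the two constants *)

Section Scaling.
Variables (R : realType) (K : nonArchLocalFieldType R).
Variable mu : forall k : nat, {measure set (borel 'cV[K]_k) -> \bar R}.
Hypothesis mu_haar : forall k : nat, normalized_haar (mu k).
Variables (n m : nat) (d : 'I_m -> nat) (c : 'I_m -> R).
Variable f : forall j : 'I_m, 'cV[K]_(d j) -> R.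
Hypothesis f_input : BL_input f.

Definition rescale (y0 : forall j : 'I_m, 'cV[K]_(d j)) (g : K) :
    forall j : 'I_m, 'cV[K]_(d j) -> R :=
  fun j y => f (g^-1 *: (y - y0 j)).

Lemma rescaleE y0 g j y : g != 0 -> rescale y0 g (y0 j + g *: y) = f y.
Proof. by move=> g0; rewrite /rescale addrAC subrr add0r scalerK. Qed.

Lemma BL_input_rescale y0 g : g != 0 -> BL_input (rescale y0 g).
Proof.
move=> g0 j; have [sbf f0 [y fy]] := f_input j; split.
- exact: schwartz_bruhat_affine.
- by move=> z; exact: f0.
- by exists (y0 j + g *: y); rewrite rescaleE.
Qed.

Lemma BL_denominator_ge0 (F : forall j : 'I_m, 'cV[K]_(d j) -> R) :
  0 <= \prod_(j < m) (\int[mu (d j)]_y F j y)%R `^ c j.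
Proof. by apply: prodr_ge0 => j _; exact: powR_ge0. Qed.

Lemma BL_denominator_rescale y0 g : g != 0 ->
  \prod_(j < m) (\int[mu (d j)]_y rescale y0 g y)%R `^ c j =
  absv g `^ (\sum_(j < m) c j * (d j)%:R) *
  \prod_(j < m) (\int[mu (d j)]_y f y)%R `^ c j.
Proof.
move=> g0; have vg0 : absv g != 0 by rewrite absv_eq0.
have -> : absv g `^ (\sum_(j < m) c j * (d j)%:R) =
    \prod_(j < m) absv g `^ (c j * (d j)%:R).
  apply: (big_morph (powR (absv g))); last by rewrite powRr0.
  by move=> x y; rewrite powRD// vg0 implybT.
rewrite -big_split/=; apply: eq_bigr => j _.
have [sbf f0 _] := f_input j; have [h h0 hf] := schwartz_bruhat_cball sbf.
have rescale_f y : rescale y0 g (y0 j + g *: y) = f y by exact: rescaleE.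
rewrite /Rintegral (integral_affine (mu_haar _) g0 h0 f0 hf rescale_f).
rewrite mulrC (mulrC (c j)) powRrM powR_mulrn ?absv_ge0//.
set I := (\int[_]_y _)%E; have I0 : (0 <= I)%E.
  by apply: integral_ge0 => y _; rewrite lee_fin.
(* For [I = +oo] both sides are 0, because [fine] sends [+oo] to 0. *)
have -> : fine ((absv g ^+ d j)%:E * I)%E = absv g ^+ d j * fine I.
  case: I I0 => [r| |]// _; rewrite gt0_muley ?mulr0//.
  by rewrite lte_fin exprn_gt0// absv_gt0.
by rewrite powRM ?fine_ge0 ?exprn_ge0 ?absv_ge0// mulrC.
Qed.

Variables (U : set 'cV[K]_n) (B : forall j : 'I_m, 'cV[K]_n -> 'cV[K]_(d j)).
Hypotheses (U_open : open U) (B_C1 : forall j : 'I_m, C1 U (B j)).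
Variable x : 'cV[K]_n.
Hypothesis Ux : U x.

Let linear_integrand (v : 'cV[K]_n) : R :=
  \prod_(j < m) f (differential U (B j) x *m v) `^ c j.

(** At scale [t = g r] the linearization error of [B_j] is at most [|t| |h_j| / |r|]. Dividing by
    [g] leaves at most [|h_j|], a displacement under which [f_j] is invariant. *)
Lemma rescaled_integrand_linearizes (r : K) : r != 0 ->
  exists g : K, [/\ g != 0, absv g <= 1, cball x (g * r) `<=` U
    & forall v, cball 0 r v -> forall j,
        rescale (fun j => B j x) g (B j (x + g *: v)) =
        f (differential U (B j) x *m v)].
Proof.
move=> r0.
have /choice[h hP] : forall j, exists h : K,
    h != 0 /\ forall y z, cball y h z -> f (j := j) z = f y.
  move=> j; have [sbf _ _] := f_input j.
  by have [h h0 hf] := schwartz_bruhat_cball sbf; exists h.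
have /choice[s sP] : forall j, exists s : K, s != 0 /\
    forall (t : K) w, absv t <= absv s -> cball 0 t w -> forall i,
      absv ((B j (x + w) - B j x - differential U (B j) x *m w) i 0) <=
      absv t * (absv (h j) / absv r).
  move=> j; have [|s s0 sB] :=
    C1_differentiable (e := absv (h j) / absv r) U_open (B_C1 j) Ux _.
    by rewrite divr_gt0// absv_gt0//; case: (hP j).
  by exists s.
have [u u0 uU] : exists2 u : K, u != 0 & cball x u `<=` U.
  by apply/nbhs_cballP; move: U_open; rewrite openE => /(_ x Ux).
have [s' s'0 s's] := exists_absv_le_family (fun j => (sP j).1).
have [t1 [t10 t1s t1u]] := exists_absv_le2 s'0 u0.
have [t [t0 tt1 tr]] := exists_absv_le2 t10 r0.
(* [|t| <= |r|] gives [|g| <= 1], [|t| <= |u|] keeps the ball in [U], and [|t| <= |s_j|] allows the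
   estimate for every [B_j]. *)
exists (t / r); split.
- by rewrite mulf_neq0// invr_eq0.
- by rewrite absvM absvV ler_pdivrMr ?mul1r ?absv_gt0.
- rewrite divfK//; apply: subset_trans uU; apply: le_cball.
  exact: le_trans t1u.
move=> v rv j; have g0 : t / r != 0 by rewrite mulf_neq0// invr_eq0.
apply: (hP j).2 => /=.
set L := differential _ _ _; set w := (t / r) *: v.
have tw : cball 0 t w.
  apply/cballP => i; have /cballP/(_ i) := rv; rewrite !mxE !subr0 !absvM => vr.
  rewrite absvV -mulrA ler_piMr ?absv_ge0// mulrC.
  by rewrite ler_pdivrMr ?mul1r ?absv_gt0.
have /(_ tw) Bw := (sP j).2 t w (le_trans tt1 (le_trans t1s (s's j))).
apply/cballP => i; have := Bw i; rewrite /w -scalemxAr -/L -/w.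
set D := B j (x + w) - B j x => DL.
rewrite (_ : _ - _ = (t / r)^-1 * ((D - (t / r) *: (L *m v)) i 0)).
  rewrite absvM absvV ler_pdivrMl ?absv_gt0// (le_trans DL)//.
  by rewrite absvM absvV mulrA mulrAC.
by move: (L *m v) D {DL} => a D; rewrite !mxE mulrBr mulKf.
Qed.

(** Provides measurability of the nonlinear integrand on all of [U]; away from [x] only continuity
    of the [B_j] is used. *)
Lemma locally_constant_rescaled_integrand (g : K) : g != 0 ->
  forall y, U y -> exists h : K, [/\ h != 0, cball y h `<=` U &
    forall z, cball y h z ->
      \prod_(j < m) rescale (fun j => B j x) g (B j z) `^ c j =
      \prod_(j < m) rescale (fun j => B j x) g (B j y) `^ c j].
Proof.
move=> g0 y Uy.
have [u u0 uU] : exists2 u : K, u != 0 & cball y u `<=` U.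
  by apply/nbhs_cballP; move: U_open; rewrite openE => /(_ y Uy).
have /choice[s sP] : forall j, exists s : K, s != 0 /\
    forall z, cball y s z -> U z ->
      rescale (fun j => B j x) g (B j z) = rescale (fun j => B j x) g (B j y).
  move=> j; have [sbf _ _] := BL_input_rescale (fun j => B j x) g0 j.
  have [h h0 hf] := schwartz_bruhat_cball sbf.
  have [/subspace_continuousP/(_ y Uy) B_cont _] := B_C1 j.
  have /B_cont : nbhs (B j y) (cball (B j y) h).
    by apply/nbhs_cballP; exists h.
  rewrite /= /within/= => /nbhs_cballP[s s0 sB]; exists s; split=> // z yz Uz.
  by apply: hf; exact: sB.
have [s' s'0 s's] := exists_absv_le_family (fun j => (sP j).1).
have [h [h0 hs' hu]] := exists_absv_le2 s'0 u0.
exists h; split=> // [|z yz]; first exact: subset_trans (le_cball hu) uU.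
apply: eq_bigr => j _; rewrite ((sP j).2 z)//.
- exact: le_cball (le_trans hs' (s's j)) _ yz.
- by apply: uU; exact: le_cball yz.
Qed.

(** By linearity one radius works at every [y], the uniformity that [integral_cball_scale] asks of
    [G]. *)
Lemma linear_integrand_cball : exists2 h : K, h != 0 &
  forall y z, cball y h z -> linear_integrand z = linear_integrand y.
Proof.
have /choice[s sP] : forall j, exists s : K, s != 0 /\
    forall y z, cball y s z ->
      f (differential U (B j) x *m z) = f (differential U (B j) x *m y).
  move=> j; have [sbf _ _] := f_input j.
  have [h h0 hf] := schwartz_bruhat_cball sbf.
  have [s s0 sh] := mulmx_cball (differential U (B j) x) h0.
  exists s; split=> // y z yz; apply: hf.
  have /sh/cballP zy : cball 0 s (z - y).
    by apply/cballP => i; have /cballP/(_ i) := yz; rewrite !mxE subr0.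
  by apply/cballP => i; have := zy i; rewrite mulmxBr !mxE subr0.
have [h h0 hs] := exists_absv_le_family (fun j => (sP j).1).
exists h => // y z yz; apply: eq_bigr => j _; rewrite ((sP j).2 y z)//.
exact: le_cball yz.
Qed.

Hypothesis dim_le : n%:R <= \sum_(j < m) c j * (d j)%:R.

Lemma BL_linear_ball_le (r : K) : r != 0 ->
  ((\int[mu n]_(v in cball 0%R r) (linear_integrand v)%:E) /
   (\prod_(j < m) (\int[mu (d j)]_y f y)%R `^ c j)%:E <=
   BL_constant mu U B c)%E.
Proof.
move=> r0; have [g [g0 g1 gU gf]] := rescaled_integrand_linearizes r0.
have vg0 : 0 < absv g by rewrite absv_gt0.
apply: le_trans (ereal_sup_ubound _); last first.
  by exists (rescale (fun j => B j x) g) => //; exact: BL_input_rescale.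
have [h h0 hG] := linear_integrand_cball.
pose F y := \prod_(j < m) rescale (fun j => B j x) g (B j y) `^ c j.
have F0 y : 0 <= F y by apply: prodr_ge0 => j _; exact: powR_ge0.
have G0 y : 0 <= linear_integrand y.
  by apply: prodr_ge0 => j _; exact: powR_ge0.
rewrite /BL_quotient BL_denominator_rescale//.
apply: le_trans (@lee_div_scale _ _ (absv g ^+ n) _ _ _ _ _ _) _.
- by apply: integral_ge0 => y _; rewrite lee_fin.
- exact: (powR_gt0 (\sum_(j < m) c j * (d j)%:R) vg0).
(* As [0 < |g| <= 1], powers of [|g|] decrease in the exponent, so [dim_le] bounds the denominator
   factor by [|g|^n]. *)
- by rewrite -powR_mulrn ?absv_ge0// ger_powR// vg0.
- exact: BL_denominator_ge0.
apply: lee_wpmul2r.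
  by rewrite inve_ge0 lee_fin mulr_ge0 ?powR_ge0// BL_denominator_ge0.
(* Read backwards, the change of variables turns the numerator into an integral over [x + g r O_n],
   a part of [U]. *)
rewrite -(@integral_cball_scale _ _ _ _ (mu_haar n) F _ x g r h)//; last first.
  by move=> y ry; apply: eq_bigr => j _; rewrite gf.
apply: ge0_subset_integral => //.
- by apply: measurable_cball; exact: mulf_neq0.
- exact: sub_sigma_algebra.
- apply: measurable_fun_locally_constant => y Uy.
  have [s [s0 sU sF]] := locally_constant_rescaled_integrand g0 Uy.
  by exists s; split=> // z yz; congr EFin; exact: sF.
- by move=> y _; rewrite lee_fin.
Qed.

Lemma BL_quotient_differential_le :
  (BL_quotient mu [set: 'cV[K]_n]
     (fun (j : 'I_m) (v : 'cV[K]_n) => differential U (B j) x *m v) c f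
   <= BL_constant mu U B c)%E.
Proof.
have [p p0 p1] := @exists_absv_lt R K 1 ltr01.
have [h h0 hG] := linear_integrand_cball.
have G0 y : 0 <= linear_integrand y.
  by apply: prodr_ge0 => j _; exact: powR_ge0.
have mG : measurable_fun setT
    (EFin \o linear_integrand : borel 'cV[K]_n -> \bar R).
  apply: measurable_fun_locally_constant => y _; exists h.
  by split=> // z /hG /= ->.
have cvgG := integral_cball_cvg (mu := mu n) 0 (oner_neq0 K) p0 p1 G0 mG.
apply: cvg_div_le cvgG _ _ _.
- by move=> i; apply: integral_ge0 => y _; rewrite lee_fin.
- exact: BL_denominator_ge0.
- move=> i; apply: BL_linear_ball_le.
  by rewrite mul1r invr_eq0 expf_neq0.
Qed.

End Scaling.

Theorem theorem1p8 (R : realType) (K : nonArchLocalFieldType R)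
  (mu : forall k : nat, {measure set (borel 'cV[K]_k) -> \bar R})
  (mu_haar : forall k : nat, normalized_haar (mu k))
  (n m : nat) (d : 'I_m -> nat)
  (U : set 'cV[K]_n) (U_open : open U) (U_nonempty : U !=set0)
  (B : forall j : 'I_m, 'cV[K]_n -> 'cV[K]_(d j))
  (B_C1 : forall j : 'I_m, C1 U (B j))
  (c : 'I_m -> R) (c_itv : forall j : 'I_m, 0 <= c j <= 1)
  (dim_le : n%:R <= \sum_(j < m) c j * (d j)%:R) :
  (ereal_sup [set BL_constant mu [set: 'cV[K]_n]
                    (fun (j : 'I_m) (v : 'cV[K]_n) =>
                       differential U (B j) x *m v) c | x in U]
   <= BL_constant mu U B c)%E.
Proof.
apply: ge_ereal_sup => _ [x Ux <-]; apply: ge_ereal_sup => _ [f f_input <-].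
exact: BL_quotient_differential_le.
Qed.
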